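(* Let $K$ be a transition matrix on $\mathcal X=\{0,1,\dots,N\}$ generated by one of the convolutions listed in the context from measures of one family (Krawtchouk, Hahn or $q$-Hahn), and suppose that for some admissible parameter $\lambda$ of the same family the symmetry condition $$K(x,y)\,\pi(y,N,\lambda)=K(y,x)\,\pi(x,N,\lambda)\qquad(x,y\in\mathcal X)$$ holds. Let $\hat\phi_0(x)=\sqrt{\pi(x,N,\lambda)}$, let $\Phi$ be the diagonal matrix with $\Phi(x,x)=\hat\phi_0(x)$, and let $\mathcal H=\Phi^{-1}K\Phi$. Then the eigenvectors of the two matrices $\mathcal H$ and $K$ are described by the orthogonal polynomials $\check P_n(x,\lambda)$ ($n\in\mathcal X$) belonging to $\pi(x,N,\lambda)$: there are real numbers $\kappa(n)$ ($n\in\mathcal X$) such that for all $n,x\in\mathcal X$ $$\sum_{y\in\mathcal X}\mathcal H(x,y)\,\hat\phi_0(y)\,\check P_n(y,\lambda)=\kappa(n)\,\hat\phi_0(x)\,\check P_n(x,\lambda),$$ $$\sum_{y\in\mathcal X}K(x,y)\,\pi(y,N,\lambda)\,\check P_n(y,\lambda)=\kappa(n)\,\pi(x,N,\lambda)\,\check P_n(x,\lambda).$$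
   Context: Notation: $N\ge1$ integer, $(a)_n=a(a+1)\cdots(a+n-1)$, $(a;q)_n=\prod_{i=0}^{n-1}(1-aq^i)$, $0<q<1$ fixed. Measures $\pi(x,M,\lambda)$ for integers $0\le x\le M$ (zero for other integer arguments), and polynomials $\check P_n(x,\lambda)$, $n,x\in\mathcal X$ (normalised by $\check P_0(x)=1$, $\check P_n(0)=1$): - Krawtchouk, $\lambda=p$, $0<p<1$: $\pi(x,M,p)=\binom{M}{x}p^x(1-p)^{M-x}$; $\check P_n(x,p)=\sum_{k=0}^n\frac{(-n)_k(-x)_k}{(-N)_k\,k!}p^{-k}$. - Hahn, $\lambda=(a,b)$, $a,b>0$: $\pi(x,M,a,b)=\binom{M}{x}\frac{(a)_x(b)_{M-x}}{(a+b)_M}$; $\check P_n(x,a,b)=\sum_{k=0}^n\frac{(-n)_k(n+a+b-1)_k(-x)_k}{(a)_k(-N)_k\,k!}$. - $q$-Hahn, $\lambda=(a,b)$, $0<a<1$, $b<1$: $\pi(x,M,a,b)=\frac{(q;q)_M}{(q;q)_x(q;q)_{M-x}}\frac{(a;q)_x(b;q)_{M-x}a^{M-x}}{(ab;q)_M}$; $\check P_n(x,a,b)=\sum_{k=0}^n\frac{(q^{-n};q)_k(abq^{n-1};q)_k(q^{-x};q)_k}{(a;q)_k(q^{-N};q)_k(q;q)_k}q^k$. Convolutions ($x,y\in\mathcal X$; $\lambda_1,\lambda_2,\lambda_3$ admissible parameters of the family; (i)–(v) allowed for Krawtchouk and Hahn, (i), (iii), (iv) for $q$-Hahn): (i) $K(x,y)=\sum_{z=0}^{\min(x,y)}\pi(x-z,N-z,\lambda_2)\,\pi(z,y,\lambda_1)$;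 (ii) $K(x,y)=\sum_{z=\max(0,x+y-N)}^{\min(x,y)}\pi(x-z,N-y,\lambda_2)\,\pi(z,y,\lambda_1)$; (iii) $K(x,y)=\sum_{z=\max(x,y)}^{N}\pi(x,z,\lambda_2)\,\pi(z-y,N-y,\lambda_1)$; (iv) $K(x,y)=\sum_{z_2=0}^{\min(x,y)}\pi(z_2,y,\lambda_1)\sum_{z_1=\max(x,y)}^{N}\pi(x-z_2,z_1-z_2,\lambda_3)\,\pi(z_1-y,N-y,\lambda_2)$; (v) $K(x,y)=\sum_{z_2=0}^{\min(x,y)}\pi(z_2,y,\lambda_1)\sum_{z_1=x+y-z_2}^{N}\pi(x-z_2,z_1-y,\lambda_3)\,\pi(z_1-y,N-y,\lambda_2)$. *)

(* Defs.v *)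
From mathcomp Require Import all_boot all_order all_algebra.
From mathcomp Require Import reals.

Set Implicit Arguments.
Unset Strict Implicit.
Unset Printing Implicit Defensive.

Import GRing.Theory Num.Theory.
Local Open Scope ring_scope.

Section Pochhammer.
Variable R : realType.

(* (a)_n *)
Definition poch (a : R) (n : nat) : R := \prod_(i < n) (a + i%:R).

(* (a; q)_n *)
Definition qpoch (q a : R) (n : nat) : R := \prod_(i < n) (1 - a * q ^+ i).

End Pochhammer.

Inductive measure_family := Krawtchouk | Hahn | QHahn.

(* The parameter lambda is p for Krawtchouk and (a, b) for the other two. *)
Definition param (R : Type) (F : measure_family) : Type :=
  match F with
  | Krawtchouk => R
  | Hahn | QHahn => (R * R)%type
  end.

Definition admissible (R : realType) (F : measure_family) : param R F -> Prop :=
  match F return param R F -> Prop with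
  | Krawtchouk => fun p => 0 < p < 1
  | Hahn => fun l => 0 < l.1 /\ 0 < l.2
  | QHahn => fun l => 0 < l.1 < 1 /\ l.2 < 1
  end.

(* [weight q F x M l] is pi(x, M, lambda), extended by zero to x > M; without
   the guard the truncated subtraction M - x would give other values there.
   Only the q-Hahn family depends on q. *)
Definition weight (R : realType) (q : R) (F : measure_family) (x M : nat) :
    param R F -> R :=
  match F return param R F -> R with
  | Krawtchouk => fun p =>
      if (x <= M)%N then 'C(M, x)%:R * p ^+ x * (1 - p) ^+ (M - x) else 0
  | Hahn => fun l => let: (a, b) := l in
      if (x <= M)%N then
        'C(M, x)%:R * (poch a x * poch b (M - x) / poch (a + b) M)
      else 0
  | QHahn => fun l => let: (a, b) := l in
      if (x <= M)%N then
        qpoch q q M / (qpoch q q x * qpoch q q (M - x)) *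
        (qpoch q a x * qpoch q b (M - x) * a ^+ (M - x) / qpoch q (a * b) M)
      else 0
  end.

(* The polynomials \check P_n(x, lambda) on {0, ..., N}.  The exponent n - 1
   of q is an integer, equal to -1 for n = 0. *)
Definition checkP (R : realType) (q : R) (F : measure_family) (N n x : nat) :
    param R F -> R :=
  match F return param R F -> R with
  | Krawtchouk => fun p =>
      \sum_(0 <= k < n.+1)
        poch (- n%:R) k * poch (- x%:R) k /
        (poch (- N%:R) k * k`!%:R) * p ^- k
  | Hahn => fun l => let: (a, b) := l in
      \sum_(0 <= k < n.+1)
        poch (- n%:R) k * poch (n%:R + a + b - 1) k * poch (- x%:R) k /
        (poch a k * poch (- N%:R) k * k`!%:R)
  | QHahn => fun l => let: (a, b) := l in
      \sum_(0 <= k < n.+1)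
        qpoch q (q ^- n) k * qpoch q (a * b * q ^ (n%:Z - 1)) k *
        qpoch q (q ^- x) k /
        (qpoch q a k * qpoch q (q ^- N) k * qpoch q q k) * q ^+ k
  end.

Inductive convolution := ConvI | ConvII | ConvIII | ConvIV | ConvV.

Definition allowed (F : measure_family) (c : convolution) : bool :=
  match F, c with
  | QHahn, (ConvII | ConvV) => false
  | _, _ => true
  end.

(* [conv q F N c l1 l2 l3] is the transition matrix K on {0, ..., N}, with
   K x y the probability of a move from y to x.  In ConvII the truncated
   difference x + y - N is max(0, x + y - N); every other subtraction is
   between a larger and a smaller number on the range of summation.  The
   parameter l3 is only used by ConvIV and ConvV. *)
Definition conv (R : realType) (q : R) (F : measure_family) (N : nat)
    (c : convolution) (l1 l2 l3 : param R F) : 'M[R]_N.+1 :=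
  let w x M l := weight q x M l in
  \matrix_(x < N.+1, y < N.+1)
  match c with
  | ConvI =>
      \sum_(0 <= z < (minn x y).+1) w (x - z)%N (N - z)%N l2 * w z y l1
  | ConvII =>
      \sum_(x + y - N <= z < (minn x y).+1)
        w (x - z)%N (N - y)%N l2 * w z y l1
  | ConvIII =>
      \sum_(maxn x y <= z < N.+1) w x z l2 * w (z - y)%N (N - y)%N l1
  | ConvIV =>
      \sum_(0 <= z2 < (minn x y).+1) w z2 y l1 *
        \sum_(maxn x y <= z1 < N.+1)
          w (x - z2)%N (z1 - z2)%N l3 * w (z1 - y)%N (N - y)%N l2
  | ConvV =>
      \sum_(0 <= z2 < (minn x y).+1) w z2 y l1 *
        \sum_(x + y - z2 <= z1 < N.+1)
          w (x - z2)%N (z1 - y)%N l3 * w (z1 - y)%N (N - y)%N l2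
  end.

Definition phi0 (R : realType) (q : R) (F : measure_family) (N : nat)
    (l : param R F) (x : nat) : R := Num.sqrt (weight q x N l).

Definition Phi (R : realType) (q : R) (F : measure_family) (N : nat)
    (l : param R F) : 'M[R]_N.+1 :=
  diag_mx (\row_(x < N.+1) phi0 q N l x).

Definition calH (R : realType) (q : R) (F : measure_family) (N : nat)
    (l : param R F) (K : 'M[R]_N.+1) : 'M[R]_N.+1 :=
  invmx (Phi q N l) *m K *m Phi q N l.

(* Main.v *)
(* The three families are one: with [n] = 1 + q + ... + q^(n-1), where q = 1 for
   Krawtchouk and Hahn, each weight is
     [M]! / ([x]! [M-x]!) * A_x B_(M-x) / C_M,
   where A, B, C are products of factors affine in [i], governed by three numbers
   (a, b, d), and the polynomials are polynomials in eta(x) = [-x].  Two one-step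
   identities, for eta(x) * weight and for [M - x] * weight, give the total mass, the
   factorial moments and, by a vanishing higher difference, the orthogonality.
   By the moment formula the mean of a polynomial of degree n in eta is a polynomial
   of degree at most n in eta(M), so the transpose of K preserves the degree in eta.
   Being self-adjoint for the weight, it is then diagonal on the orthogonal polynomials. *)
Require Import Defs.
From mathcomp Require Import all_boot all_order all_algebra.
From mathcomp Require Import reals.
From mathcomp Require Import ring zify.

Set Implicit Arguments.
Unset Strict Implicit.
Unset Printing Implicit Defensive.

Import Order.TTheory GRing.Theory Num.Theory.
Local Open Scope ring_scope.

(** * Polynomial bases with one element in each degree *)

Section PolynomialBases.
Variable R : fieldType.

Lemma size_prod_linear_leq (u v : nat -> R) k :
  (size (\prod_(i < k) ((u i)%:P + v i *: 'X))%R <= k.+1)%N.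
Proof.
elim: k => [|k IH]; first by rewrite big_ord0 size_poly1.
rewrite big_ord_recr /=; apply: leq_trans (size_polyMleq _ _) _.
have : (size ((u k)%:P + v k *: 'X)%R <= 2)%N.
  apply: leq_trans (size_polyD _ _) _; rewrite geq_max (leq_trans (size_polyC_leq1 _)) //.
  by rewrite (leq_trans (size_scale_leq _ _)) // size_polyX.
move: IH; move: (size _) (size _) => m1 m2. lia.
Qed.

Lemma size_prod_linear (u v : nat -> R) k : (forall i, v i != 0) ->
  size (\prod_(i < k) ((u i)%:P + v i *: 'X)) = k.+1.
Proof.
move=> hv; have szf i : size ((u i)%:P + v i *: 'X) = 2%N.
  by rewrite addrC size_polyDl size_scale ?size_polyX // size_polyC; case: (_ == _).
elim: k => [|k IH]; first by rewrite big_ord0 size_poly1.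
by rewrite big_ord_recr size_mul /= ?IH ?szf ?addn2 // -size_poly_gt0 ?IH ?szf.
Qed.

Lemma triangular_basis (G : nat -> {poly R}) n (p : {poly R}) :
  (forall k, size (G k) = k.+1) -> (size p <= n)%N ->
  exists c : nat -> R, p = \sum_(k < n) c k *: G k.
Proof.
move=> hG; elim: n p => [|n IH] p.
  by rewrite size_poly_leq0 => /eqP->; exists (fun=> 0); rewrite big_ord0.
move=> szp; set e := p`_n / lead_coef (G n).
have Gn0 : lead_coef (G n) != 0 by rewrite lead_coef_eq0 -size_poly_gt0 hG.
have [|c hc] := IH (p - e *: G n).
  apply/leq_sizeP => j; rewrite leq_eqVlt => /predU1P[<-|lt].
    have eG : (G n)`_n = lead_coef (G n) by rewrite lead_coefE hG.
    by rewrite coefB coefZ eG divfK ?subrr.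
  by rewrite coefB coefZ !nth_default ?mulr0 ?subrr ?hG // (leq_trans szp).
exists (fun k => if k == n then e else c k).
rewrite big_ord_recr /= eqxx -[LHS](subrK (e *: G n)) hc; congr (_ + _).
by apply: eq_bigr => k _; rewrite ltn_eqF.
Qed.

Lemma size_sum_triangular (G : nat -> {poly R}) n (c : nat -> R) :
  (forall k, size (G k) = k.+1) -> (size (\sum_(k < n) c k *: G k)%R <= n)%N.
Proof.
move=> hG; apply: leq_trans (size_sum _ _ _) _; apply/bigmax_leqP => k _.
by rewrite (leq_trans (size_scale_leq _ _)) // hG.
Qed.

End PolynomialBases.

(** * q-integers and the Newton basis *)

Section QNumbers.
Variables (R : realFieldType) (q : R).
Hypothesis q_gt0 : 0 < q.

Definition qint (n : nat) : R := \sum_(i < n) q ^+ i.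
Definition qfact (n : nat) : R := \prod_(i < n) qint i.+1.
Definition eta (x : nat) : R := - (q ^- x * qint x).
(** A common form of three products: (c)_n for [q = 1] and [e = 1], c^n for [e = 0], and (e; q)_n up
    to the factor (1 - q)^n for [c = (1 - e) / (1 - q)]. *)
Definition qprod (c e : R) (n : nat) : R := \prod_(i < n) (c + e * qint i).
(** At [eta x] the factors are [i - x], so the value [-x][1 - x]...[k - 1 - x] is the analogue of
    (-x)_k; times (1 - q)^k it is (q^-x; q)_k. *)
Definition newton (k : nat) : {poly R} :=
  \prod_(i < k) ((qint i)%:P + q ^+ i *: 'X).

Lemma qint0 : qint 0 = 0. Proof. by rewrite /qint big_ord0. Qed.

Lemma qintS n : qint n.+1 = 1 + q * qint n.
Proof.
rewrite /qint big_ord_recl expr0 mulr_sumr; congr (_ + _).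
by apply: eq_bigr => i _; rewrite -exprS.
Qed.

Lemma qintD m n : qint (m + n) = qint m + q ^+ m * qint n.
Proof.
elim: m => [|m IH]; first by rewrite qint0 expr0 mul1r add0r.
by rewrite addSn !qintS IH exprS; ring.
Qed.

Lemma expr_qint n : q ^+ n = 1 - (1 - q) * qint n.
Proof.
elim: n => [|n IH]; first by rewrite qint0 expr0; ring.
by rewrite exprS IH qintS; ring.
Qed.

Lemma qint_gt0 n : 0 < qint n.+1.
Proof.
rewrite /qint big_ord_recl expr0 ltr_wpDr ?ltr01 //.
by apply: sumr_ge0 => i _; rewrite exprn_ge0 // ltW.
Qed.

Lemma qfact_neq0 n : qfact n != 0.
Proof. by apply/prodf_neq0 => i _; rewrite gt_eqF ?qint_gt0. Qed.

Lemma qfactS n : qfact n.+1 = qfact n * qint n.+1.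
Proof. by rewrite /qfact big_ord_recr. Qed.

Lemma qexp_neq0 n : q ^+ n != 0.
Proof. by rewrite expf_neq0 // gt_eqF. Qed.

Lemma eta0 : eta 0 = 0. Proof. by rewrite /eta qint0 mulr0 oppr0. Qed.

Lemma expr_eta n : q ^- n = 1 - (1 - q) * eta n.
Proof.
have : q ^+ n * q ^- n = 1 by rewrite mulfV ?qexp_neq0.
rewrite /eta; set u := q ^- n; rewrite expr_qint.
by move/eqP; rewrite mulrBl mul1r subr_eq => /eqP {1}->; ring.
Qed.

Lemma etaD x y : eta (x + y) = eta x + q ^- x * eta y.
Proof.
rewrite /eta addnC qintD exprD; move: (qexp_neq0 x) (qexp_neq0 y).
move: (q ^+ x) (q ^+ y) (qint x) (qint y) => u v a b hu hv.
by field; rewrite hu hv.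
Qed.

Lemma eta_qint n : q ^+ n * eta n = - qint n.
Proof. by rewrite /eta mulrN mulrA mulfV ?qexp_neq0 // mul1r. Qed.

Lemma qint_subr M x : (x <= M)%N -> qint (M - x) = qint M + q ^+ M * eta x.
Proof.
move=> le; rewrite -{2 3}(subnK le) qintD exprD -mulrA eta_qint; ring.
Qed.

Lemma eta_neq0 n : eta n.+1 != 0.
Proof. by rewrite oppr_eq0 mulf_neq0 ?invr_neq0 ?qexp_neq0 // gt_eqF ?qint_gt0. Qed.

Lemma qprod0 c e : qprod c e 0 = 1. Proof. by rewrite /qprod big_ord0. Qed.

Lemma qprodS c e n : qprod c e n.+1 = qprod c e n * (c + e * qint n).
Proof. by rewrite /qprod big_ord_recr. Qed.

(** Since [i + 1] = 1 + q[i], dropping the first factor only changes the two parameters. The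
    parameter shifts of the weights come from this and from [qprodZ]. *)
Lemma qprodSl c e n : qprod c e n.+1 = c * qprod (c + e) (q * e) n.
Proof.
rewrite /qprod big_ord_recl qint0 mulr0 addr0; congr (_ * _).
by apply: eq_bigr => i _; rewrite lift0 qintS; ring.
Qed.

Lemma qprodZ u c e n : qprod (u * c) (u * e) n = u ^+ n * qprod c e n.
Proof.
elim: n => [|n IH]; first by rewrite !qprod0 expr0 mulr1.
by rewrite !qprodS IH exprS; ring.
Qed.

Lemma newton0 : newton 0 = 1. Proof. by rewrite /newton big_ord0. Qed.

Lemma newtonS k : newton k.+1 = newton k * ((qint k)%:P + q ^+ k *: 'X).
Proof. by rewrite /newton big_ord_recr. Qed.

Lemma size_newton k : size (newton k) = k.+1.
Proof. exact: (size_prod_linear qint _ (fun i => qexp_neq0 i)). Qed.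

Lemma horner_newton k x : (newton k).[x] = \prod_(i < k) (qint i + q ^+ i * x).
Proof. by rewrite horner_prod; apply: eq_bigr => i _; rewrite !hornerE. Qed.

(** At j + x the last k factors are [j + i - (j + x)] = [i - x]. *)
Lemma newton_etaD j k x :
  (newton (j + k)).[eta (j + x)] = (newton j).[eta (j + x)] * (newton k).[eta x].
Proof.
rewrite !horner_newton big_split_ord /=; congr (_ * _); apply: eq_bigr => i _.
rewrite addnC qintD exprD etaD; have /mulfV := qexp_neq0 j; have := eta_qint j.
move: (q ^+ j) (q ^+ i) (q ^- j) => u v u' h h'.
have -> : v * u * (eta j + u' * eta x) = v * (u * eta j) + v * (u * u') * eta x by ring.
by rewrite h h'; ring.
Qed.

Lemma newton_etaS k x :
  (newton k.+1).[eta x.+1] = eta x.+1 * (newton k).[eta x].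
Proof.
have := newton_etaD 1 k x; rewrite !add1n => ->; congr (_ * _).
by rewrite horner_newton big_ord1 qint0 expr0 add0r mul1r.
Qed.

Lemma newton_eta_eq0 k x : (x < k)%N -> (newton k).[eta x] = 0.
Proof.
move=> lt; rewrite horner_newton (bigD1 (Ordinal lt)) //= eta_qint; ring.
Qed.

Lemma newton_eta_neq0 k x : (k <= x)%N -> (newton k).[eta x] != 0.
Proof.
elim: k x => [|k IH] [|x] //; rewrite ?newton0 ?hornerC ?oner_neq0 //.
by move=> /IH h; rewrite newton_etaS mulf_neq0 ?eta_neq0.
Qed.

(** For q = 1 this is the partial alternating sum of binomials: the sum of (-1)^k C(n+1, k) over k
    <= m equals (-1)^m C(n, m). *)
Lemma sum_newton_telescope n m :
  \sum_(k < m.+1) (newton k).[eta n.+1] * q ^+ k / qfact k =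
  (newton m).[eta n] / qfact m.
Proof.
elim: m => [|m IH].
  by rewrite big_ord1 newton0 !hornerC expr0 /= mulr1.
rewrite big_ord_recr /= {}IH newton_etaS newtonS hornerM !hornerE.
rewrite qfactS -[n.+1]add1n etaD expr1.
have := qfact_neq0 m; have : qint m.+1 != 0 by rewrite gt_eqF ?qint_gt0.
have e1 : eta 1 = - q^-1 by rewrite /eta qintS qint0 expr1; ring.
have hq : q != 0 by rewrite gt_eqF.
have e2 : qint m.+1 = qint m + q ^+ m by rewrite -addn1 qintD qintS qint0; ring.
rewrite e2 e1 exprS.
by move=> h1 h2; field; rewrite h1 h2 hq.
Qed.

(* For q = 1: n-th finite differences kill polynomials of degree < n. *)
Lemma sum_newton_qint n (p : {poly R}) : (size p <= n)%N ->
  \sum_(k < n.+1) (newton k).[eta n] * q ^+ k / qfact k * p.[qint k] = 0.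
Proof.
elim: n p => [|n IH] p.
  by rewrite leqn0 size_poly_eq0 => /eqP->; rewrite big1 // => k _; rewrite horner0 mulr0.
elim/poly_ind: p => [|p c _]; first by rewrite big1 // => k _; rewrite horner0 mulr0.
rewrite size_MXaddC; case: ifP => [/andP[/eqP-> /eqP->] _|_ szp].
  by rewrite big1 // => k _; rewrite mul0r addr0 horner0 mulr0.
under eq_bigr do rewrite !hornerE mulrDr.
(* The constant term of p meets the complete alternating sum, which is zero. In the rest the factor
   [k] kills k = 0 and cancels in [k]!, so the shift k -> k + 1 leads to the case n with the
   polynomial p(1 + qX). *)
rewrite big_split /= -mulr_suml sum_newton_telescope newton_eta_eq0 // !mul0r addr0.
rewrite big_ord_recl qint0 !mulr0 add0r.
have := IH (p \Po (1 + q *: 'X)); rewrite size_comp_poly2; last first.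
  by rewrite addrC size_polyDl ?size_poly1 size_scale ?size_polyX ?gt_eqF.
move=> /(_ szp) /(congr1 ( *%R (eta n.+1 * q))); rewrite mulr0 mulr_sumr => h.
rewrite -[RHS]h; apply: eq_bigr => k _; rewrite lift0 newton_etaS horner_comp !hornerE.
rewrite qfactS -qintS exprS; have := qfact_neq0 k => h1.
have h2 : qint k.+1 != 0 by rewrite gt_eqF ?qint_gt0.
rewrite /=.
by field; rewrite h1 h2.
Qed.
End QNumbers.

(** * The common weight and its moments *)

Section Weights.
Variables (R : realFieldType) (q : R).
Hypothesis q_gt0 : 0 < q.

Local Notation qint := (qint q).
Local Notation qfact := (qfact q).
Local Notation eta := (eta q).
Local Notation qprod := (qprod q).
Local Notation newton := (newton q).

(* Chosen so that (a + slope b d * [x]) + q^x (b + d * [M - x]) = a + b + d * [M]. *)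
Definition slope (b d : R) : R := d + (1 - q) * b.

Definition wt (a b d : R) (x M : nat) : R :=
  qfact M / (qfact x * qfact (M - x)) *
  (qprod a (slope b d) x * qprod b d (M - x) / qprod (a + b) d M).

Definition mean (a b d : R) (M : nat) (f : nat -> R) : R :=
  \sum_(x < M.+1) wt a b d x M * f x.

(** Demanding positivity for every i makes the condition stable under the parameter shifts, with no
    bound to carry along. *)
Definition positive_parameters (a b d : R) : Prop :=
  forall i, 0 < a + slope b d * qint i /\ 0 < b + d * qint i.

(* The predecessor n.-1 is only met for k > 0, hence for n > 0. *)
Definition orthopoly (a b d : R) (N n : nat) : {poly R} :=
  \sum_(k < n.+1)
    ((newton k).[eta n] * \prod_(i < k) (a + b + d * qint (n.-1 + i)) /
     (qprod a (slope b d) k * (newton k).[eta N] * qfact k) * q ^+ k)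
    *: newton k.

Section Positive.
Variables a b d : R.
Hypothesis pos : positive_parameters a b d.

Lemma parameter_a_gt0 : 0 < a.
Proof. by have [] := pos 0; rewrite qint0 mulr0 addr0. Qed.

Lemma parameter_sum_gt0 i : 0 < a + b + d * qint i.
Proof. by rewrite -addrA addr_gt0 ?parameter_a_gt0 //; have [] := pos i. Qed.

Lemma qprod_neq0 n :
  [/\ 0 < qprod a (slope b d) n, 0 < qprod b d n & 0 < qprod (a + b) d n].
Proof.
by split; apply: prodr_gt0 => i _; rewrite ?parameter_sum_gt0 //; have [] := pos i.
Qed.

Lemma qfact_gt0 n : 0 < qfact n.
Proof. by apply: prodr_gt0 => i _; apply: qint_gt0. Qed.

Lemma wt_gt0 x M : 0 < wt a b d x M.
Proof.
have [A _ _] := qprod_neq0 x; have [_ B _] := qprod_neq0 (M - x).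
have [_ _ C] := qprod_neq0 M.
by rewrite /wt !(mulr_gt0, invr_gt0, qfact_gt0).
Qed.

Lemma positive_parametersS :
  positive_parameters (a + slope b d) (q * b) (q * d).
Proof.
move=> i; have [h1 _] := pos i.+1; have [_ h2] := pos i.
split; last by rewrite -mulrA -mulrDr mulr_gt0.
by move: h1; rewrite qintS /slope; congr (_ < _); ring.
Qed.

Lemma positive_parameters_compl : positive_parameters a (b + d) (q * d).
Proof.
move=> i; have [h1 _] := pos i; have [_ h2] := pos i.+1; split.
  by move: h1; rewrite /slope; congr (_ < _); ring.
by move: h2; rewrite qintS; congr (_ < _); ring.
Qed.

(** The factor [x + 1] of eta(x + 1) cancels in [x + 1]!, and A and C lose their first factors. The
    quotient of the powers of q in eta(x + 1) and eta(M + 1) is q^(M-x), which is absorbed by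
    scaling the M - x factors of B by q. *)
Lemma wt_eta x M : (x <= M)%N ->
  wt a b d x.+1 M.+1 * eta x.+1 =
  a / (a + b) * eta M.+1 * wt (a + slope b d) (q * b) (q * d) x M.
Proof.
move=> le; rewrite /wt subSS !qfactS !(qprodSl _ a) !(qprodSl _ (a + b)) qprodZ.
have -> : slope (q * b) (q * d) = q * slope b d by rewrite /slope; ring.
have -> : a + slope b d + q * b = a + b + d by rewrite /slope; ring.
have [A B C] : [/\ qprod (a + b + d) (q * d) M != 0, a + b != 0 & q != 0].
  have [_ _ /lt0r_neq0] := qprod_neq0 M.+1.
  rewrite qprodSl mulf_eq0 negb_or => /andP[h1 h2].
  by split=> //; rewrite gt_eqF.
have e : q ^+ M = q ^+ x * q ^+ (M - x) by rewrite -exprD subnKC.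
rewrite /eta !exprS e.
have := qfact_neq0 q_gt0 x; have := qfact_neq0 q_gt0 (M - x).
have /lt0r_neq0 := qint_gt0 q_gt0 x; have /lt0r_neq0 := qint_gt0 q_gt0 M.
have := qexp_neq0 q_gt0 x; have := qexp_neq0 q_gt0 (M - x).
move=> h1 h2 h3 h4 h5 h6; field.
by rewrite h1 h2 h4 h5 h6 A B C.
Qed.

(** Now [M + 1 - x] cancels in its factorial, and B and C lose their first factors. A stays, because
    the slope is invariant under this shift. *)
Lemma wt_compl x M : (x <= M)%N ->
  wt a b d x M.+1 * qint (M.+1 - x) =
  b / (a + b) * qint M.+1 * wt a (b + d) (q * d) x M.
Proof.
move=> le; rewrite /wt subSn // !qfactS !(qprodSl _ b) !(qprodSl _ (a + b)).
have -> : slope (b + d) (q * d) = slope b d by rewrite /slope; ring.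
rewrite addrA.
have [A B] : qprod (a + b + d) (q * d) M != 0 /\ a + b != 0.
  have [_ _ /lt0r_neq0] := qprod_neq0 M.+1.
  by rewrite qprodSl mulf_eq0 negb_or => /andP[].
have := qfact_neq0 q_gt0 x; have := qfact_neq0 q_gt0 (M - x).
have /lt0r_neq0 := qint_gt0 q_gt0 (M - x).
move=> h1 h2 h3; field.
by rewrite h1 h2 h3 A B.
Qed.

Lemma mean_eta M f :
  mean a b d M.+1 (fun x => eta x * f x) =
  a / (a + b) * eta M.+1 *
  mean (a + slope b d) (q * b) (q * d) M (fun x => f x.+1).
Proof.
rewrite /mean big_ord_recl eta0 mul0r mulr0 add0r mulr_sumr.
by apply: eq_bigr => x _; rewrite lift0 mulrA wt_eta -?mulrA // -ltnS.
Qed.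

Lemma mean_compl M f :
  mean a b d M.+1 (fun x => qint (M.+1 - x) * f x) =
  b / (a + b) * qint M.+1 * mean a (b + d) (q * d) M f.
Proof.
rewrite /mean big_ord_recr /= subnn qint0 mul0r mulr0 addr0 mulr_sumr.
by apply: eq_bigr => x _; rewrite mulrA wt_compl -?mulrA // -ltnS.
Qed.

Lemma mean_sum (I : Type) (r : seq I) M (c : I -> R) (f : I -> nat -> R) :
  mean a b d M (fun x => \sum_(i <- r) c i * f i x) =
  \sum_(i <- r) c i * mean a b d M (f i).
Proof.
rewrite /mean; under eq_bigr do rewrite mulr_sumr.
rewrite exchange_big; apply: eq_bigr => i _; rewrite mulr_sumr.
by apply: eq_bigr => x _; rewrite mulrCA.
Qed.

Lemma eq_mean M f g : (forall x, (x <= M)%N -> f x = g x) ->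
  mean a b d M f = mean a b d M g.
Proof. by move=> h; apply: eq_bigr => x _; rewrite h // -ltnS. Qed.

Lemma meanD M f g :
  mean a b d M (fun x => f x + g x) = mean a b d M f + mean a b d M g.
Proof. by rewrite /mean -big_split; apply: eq_bigr => x _; rewrite mulrDr. Qed.

Lemma meanZ M c f : mean a b d M (fun x => c * f x) = c * mean a b d M f.
Proof. by rewrite /mean mulr_sumr; apply: eq_bigr => x _; rewrite mulrCA. Qed.

End Positive.

(* Splitting [M] = [M - x] - q^M eta(x) reduces the total mass at M + 1 to the
   total masses at M for the two shifted parameters. *)
Lemma mean1 a b d M : positive_parameters a b d -> mean a b d M (fun=> 1) = 1.
Proof.
elim: M a b d => [|M IH] a b d pos.
  by rewrite /mean big_ord1 /wt subnn /qfact big_ord0 !qprod0 /= !mul1r !invr1 !mulr1.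
have /lt0r_neq0 hM := qint_gt0 q_gt0 M; apply: (mulfI hM).
rewrite -meanZ.
rewrite (@eq_mean _ _ _ _ _ (fun x =>
    qint (M.+1 - x) * 1 + (- q ^+ M.+1) * (eta x * 1))); last first.
  by move=> x le; rewrite (qint_subr q_gt0 le); ring.
rewrite meanD meanZ mean_compl // mean_eta // !IH; last 2 first.
- exact: positive_parametersS.
- exact: positive_parameters_compl.
have := parameter_sum_gt0 pos 0; rewrite qint0 mulr0 addr0 => /lt0r_neq0 h.
have -> : - q ^+ M.+1 * (a / (a + b) * eta M.+1 * 1) =
          - (q ^+ M.+1 * eta M.+1) * (a / (a + b)) by ring.
by rewrite eta_qint //; field.
Qed.

(** The factorial moments. By [newton_etaS] a factor eta(x) splits off, and [mean_eta] trades it for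
    shifted parameters, that is, for the first factors of the two products. *)
Lemma mean_newton a b d k M : positive_parameters a b d ->
  mean a b d M (fun x => (newton k).[eta x]) =
  qprod a (slope b d) k / qprod (a + b) d k * (newton k).[eta M].
Proof.
elim: k M a b d => [|k IH] M a b d pos.
  rewrite newton0 hornerC !qprod0 (@eq_mean _ _ _ _ _ (fun=> 1)); last first.
    by move=> x _; rewrite hornerC.
  by rewrite mean1 //; field.
case: M => [|M].
  rewrite /mean big_ord1 newton_eta_eq0 //; ring.
(* At x = 0 the truncated [x.-1] does no harm, since [eta 0 = 0]. *)
have -> : mean a b d M.+1 (fun x => (newton k.+1).[eta x]) =
          mean a b d M.+1 (fun x => eta x * (newton k).[eta x.-1]).
  apply: eq_mean => -[|x] _; last by rewrite newton_etaS.
  by rewrite newton_eta_eq0 // eta0 mul0r.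
rewrite (mean_eta pos) /= IH; last exact: positive_parametersS.
rewrite !qprodSl newton_etaS //.
have -> : slope (q * b) (q * d) = q * slope b d by rewrite /slope; ring.
have -> : a + slope b d + q * b = a + b + d by rewrite /slope; ring.
have [A B] : qprod (a + b + d) (q * d) k != 0 /\ a + b != 0.
  have [_ _ /lt0r_neq0] := qprod_neq0 pos k.+1.
  by rewrite qprodSl mulf_eq0 negb_or => /andP[].
by field; rewrite A B.
Qed.

End Weights.

(** * Orthogonality *)

Section Orthogonality.
Variables (R : realFieldType) (q : R).
Hypothesis q_gt0 : 0 < q.

Local Notation qint := (qint q).
Local Notation qfact := (qfact q).
Local Notation eta := (eta q).
Local Notation qprod := (qprod q).
Local Notation newton := (newton q).
Local Notation slope := (slope q).
Local Notation mean := (mean q).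
Local Notation positive_parameters := (positive_parameters q).
Local Notation orthopoly := (orthopoly q).

(** By [mean_newton] the mean acts diagonally on the Newton basis, with coefficients independent of
    M; hence one p' serves for all M. *)
Lemma mean_poly a b d n (p : {poly R}) :
  positive_parameters a b d -> (size p <= n)%N ->
  exists2 p' : {poly R}, (size p' <= n)%N &
    forall M, mean a b d M (fun x => p.[eta x]) = p'.[eta M].
Proof.
move=> pos szp; have [c ->] := triangular_basis (size_newton q_gt0) szp.
exists (\sum_(k < n) (c k * (qprod a (slope b d) k / qprod (a + b) d k)) *: newton k).
  exact: (size_sum_triangular _
    (fun k => c k * (qprod a (slope b d) k / qprod (a + b) d k)) (size_newton q_gt0)).
move=> M; rewrite horner_sum.
rewrite -(@eq_mean _ _ _ _ _ _ (fun x => \sum_(k < n) c k * (newton k).[eta x])).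
  rewrite mean_sum; apply: eq_bigr => k _.
  by rewrite (mean_newton q_gt0 _ _ pos) hornerZ mulrA.
by move=> x _; rewrite horner_sum; apply: eq_bigr => k _; rewrite hornerZ.
Qed.

(** At [eta x] this is [N - x][N - 1 - x]...[N - j + 1 - x], a falling factorial in the
    complementary variable. *)
Definition coNewton N j : {poly R} :=
  \prod_(i < j) ((qint (N - i))%:P + q ^+ (N - i) *: 'X).

Lemma size_coNewton N j : size (coNewton N j) = j.+1.
Proof.
exact: (size_prod_linear (fun i => qint (N - i)) _ (fun i => qexp_neq0 q_gt0 (N - i))).
Qed.

(** [mean_compl] applied j times; each step removes one factor and lowers N by one. The resulting
    parameters are b + d[j] and q^j d, recorded through the relations that enter the moment
    formula. *)
Lemma mean_coNewton a b d N j : positive_parameters a b d -> (j <= N)%N ->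
  exists b' d' C,
  [/\ positive_parameters a b' d', slope b' d' = slope b d,
      forall i, a + b' + d' * qint i = a + b + d * qint (j + i) &
      forall f, mean a b d N (fun x => (coNewton N j).[eta x] * f x) =
                C * mean a b' d' (N - j) f].
Proof.
elim: j N b d => [|j IH] [|N] b d pos le //.
- exists b, d, 1; split=> // f; rewrite mul1r subn0; apply: eq_mean => x _.
  by rewrite /coNewton big_ord0 hornerC mul1r.
- exists b, d, 1; split=> // f; rewrite mul1r subn0; apply: eq_mean => x _.
  by rewrite /coNewton big_ord0 hornerC mul1r.
have [b' [d' [C [pos' hs hi hm]]]] := IH N _ _ (positive_parameters_compl pos) le.
exists b', d', (b / (a + b) * qint N.+1 * C); split=> //.
- by rewrite hs /slope; ring.
- by move=> i; rewrite hi addSn qintS; ring.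
move=> f; rewrite subSS -mulrA -hm -mean_compl //; apply: eq_mean => x lx.
rewrite /coNewton big_ord_recl hornerM !hornerE subn0 -(qint_subr q_gt0 lx).
rewrite /= -mulrA; congr (_ * (_.[_] * _)); exact: eq_bigr.
Qed.

(** Both sides are the product of F over j, ..., j + m + k - 1, split after m or after k factors. *)
Lemma prod_shift_ratio (F : nat -> R) j m k :
  \prod_(i < k) F (j + m + i)%N * \prod_(i < m) F (j + i)%N =
  \prod_(i < k) F (j + i)%N * \prod_(i < m) F (j + i + k)%N.
Proof.
transitivity (\prod_(i < m + k) F (j + i)%N).
  rewrite big_split_ord /= mulrC; congr (_ * _).
  by apply: eq_bigr => i _; rewrite addnA.
rewrite addnC big_split_ord /=; congr (_ * _).
by apply: eq_bigr => i _; rewrite addnAC addnA.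
Qed.

(** Both sides are [newton (j + k)] at [eta N], split after j or after k factors. In the second
    splitting the last j factors [k + i - N] are affine in [k]. *)
Lemma newton_shift_ratio N j k : (j <= N)%N ->
  (newton k).[eta (N - j)] * (newton j).[eta N] =
  (newton k).[eta N] *
  \prod_(i < j) (qint i + q ^+ i * eta N + q ^+ i * (1 - (1 - q) * eta N) * qint k).
Proof.
move=> le; transitivity (newton (j + k)).[eta N].
  by rewrite -{3}(subnKC le) newton_etaD // subnKC // mulrC.
rewrite addnC !horner_newton big_split_ord /=; congr (_ * _); apply: eq_bigr => i _.
by rewrite addnC qintD exprD (expr_qint q k); ring.
Qed.

(** It suffices to test against [coNewton N j] for j < n. This factor only changes the parameters,
    and the moments then turn the mean into the sum of [sum_newton_qint] for a polynomial in [k] of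
    degree at most n - 1. *)
Lemma orthopoly_orthogonal a b d N n (p : {poly R}) : positive_parameters a b d ->
  (n <= N)%N -> (size p <= n)%N ->
  mean a b d N (fun x => p.[eta x] * (orthopoly a b d N n).[eta x]) = 0.
Proof.
move=> pos leN szp; have [c ->] := triangular_basis (size_coNewton N) szp.
rewrite (@eq_mean _ _ _ _ _ _ _ (fun x => \sum_(j < n) c j *
   ((coNewton N j).[eta x] * (orthopoly a b d N n).[eta x]))); last first.
  by move=> x _; rewrite horner_sum mulr_suml; apply: eq_bigr => j _; rewrite hornerZ mulrA.
rewrite mean_sum big1 // => -[j ltj] _ /=.
have lej : (j <= N)%N by rewrite ltnW // (leq_trans ltj).
have [b' [d' [C [pos' hs hi ->]]]] := mean_coNewton pos lej.
set m := (n.-1 - j)%N; have em : (n.-1 = j + m)%N by rewrite /m; lia.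
(* Up to constants in k, r1([k]) is the quotient of the products of a + b + d[n-1+i] and a + b +
   d[j+i] over i < k, and r2([k]) that of [newton k] at eta(N - j) and eta(N). Their degrees are at
   most m = n - 1 - j and j. *)
pose r1 : {poly R} :=
  \prod_(i < m) ((a + b + d * qint (j + i))%:P + (d * q ^+ (j + i)) *: 'X).
pose r2 : {poly R} := \prod_(i < j) ((qint i + q ^+ i * eta N)%:P +
                                 (q ^+ i * (1 - (1 - q) * eta N)) *: 'X).
have szr : (size (r1 * r2)%R <= n)%N.
  apply: leq_trans (size_polyMleq _ _) _.
  have := size_prod_linear_leq (fun i => a + b + d * qint (j + i)) (fun i => d * q ^+ (j + i)) m.
  have := size_prod_linear_leq (fun i => qint i + q ^+ i * eta N)
    (fun i => q ^+ i * (1 - (1 - q) * eta N)) j.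
  by rewrite -/r1 -/r2; move: (size r1) (size r2) => s1 s2; move: em ltj; clear; lia.
rewrite (@eq_mean _ _ _ _ _ _ _ (fun x => \sum_(k < n.+1)
  ((newton k).[eta n] * \prod_(i < k) (a + b + d * qint (n.-1 + i)) /
     (qprod a (slope b d) k * (newton k).[eta N] * qfact k) * q ^+ k) *
  (newton k).[eta x])); last first.
  by move=> x _; rewrite horner_sum; apply: eq_bigr => k _; rewrite hornerZ.
rewrite mean_sum.
have := sum_newton_qint q_gt0 szr.
(* The divisor collects the constants of the two quotients. *)
move=> /(congr1 (fun t => t / (\prod_(i < m) (a + b + d * qint (j + i)) * (newton j).[eta N]))).
rewrite mul0r mulr_suml => hsum.
suff -> : \sum_(k < n.+1)
  ((newton k).[eta n] * \prod_(i < k) (a + b + d * qint (n.-1 + i)) /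
     (qprod a (slope b d) k * (newton k).[eta N] * qfact k) * q ^+ k) *
  mean a b' d' (N - j) (fun x => (newton k).[eta x]) = 0 by rewrite !mulr0.
rewrite -[RHS]hsum; apply: eq_bigr => -[k ltk] _ /=.
have lek : (k <= N)%N by rewrite (leq_trans _ leN).
rewrite (mean_newton q_gt0 _ _ pos') hs hornerM.
have -> : qprod (a + b') d' k = \prod_(i < k) (a + b + d * qint (j + i)).
  by apply: eq_bigr => i _; rewrite hi.
have hr1 : r1.[qint k] = \prod_(i < m) (a + b + d * qint (j + i + k)).
  rewrite horner_prod; apply: eq_bigr => i _.
  by rewrite !hornerE (qintD q (j + i)); ring.
have hr2 : r2.[qint k] = \prod_(i < j)
    (qint i + q ^+ i * eta N + q ^+ i * (1 - (1 - q) * eta N) * qint k).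
  by rewrite horner_prod; apply: eq_bigr => i _; rewrite !hornerE.
have /= e2 := prod_shift_ratio (fun i => a + b + d * qint i) j m k.
have e1 := newton_shift_ratio k lej; move: e1 e2; rewrite -hr2 -hr1 -em.
have := newton_eta_neq0 q_gt0 lek; have := newton_eta_neq0 q_gt0 lej.
have := qfact_neq0 q_gt0 k; have [/lt0r_neq0 + _ _] := qprod_neq0 pos k.
have hF l : \prod_(i < l) (a + b + d * qint (j + i)) != 0.
  by apply/prodf_neq0 => i _; rewrite gt_eqF ?parameter_sum_gt0.
move: (hF k) (hF m).
set u := \prod_(i < k) _; set v := \prod_(i < m) _; set w := \prod_(i < k) _.
move=> hu hv hA hf hz hy e1 e2.
have -> : (newton k).[eta (N - j)] = (newton k).[eta N] * r2.[qint k] / (newton j).[eta N].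
  by rewrite -e1 mulfK.
have -> : w = u * r1.[qint k] / v by rewrite -e2 mulfK.
by field; rewrite hu hv hA hf hz hy.
Qed.

(** The leading coefficient is nonzero: [newton n] vanishes neither at eta(n) nor, as n <= N, at
    eta(N). *)
Lemma size_orthopoly a b d N n : positive_parameters a b d -> (n <= N)%N ->
  size (orthopoly a b d N n) = n.+1.
Proof.
move=> pos le; rewrite /orthopoly big_ord_recr /= addrC.
set c := _ * q ^+ n.
have hc : c != 0.
  have h : \prod_(i < n) (a + b + d * qint (n.-1 + i)) != 0.
    by apply/prodf_neq0 => i _; rewrite gt_eqF ?parameter_sum_gt0.
  have [/lt0r_neq0 h1 _ _] := qprod_neq0 pos n.
  by rewrite !(mulf_neq0, invr_neq0, newton_eta_neq0, qexp_neq0, qfact_neq0).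
rewrite size_polyDl size_scale // size_newton // ltnS.
apply: leq_trans (size_sum _ _ _) _; apply/bigmax_leqP => k _.
by rewrite (leq_trans (size_scale_leq _ _)) // size_newton.
Qed.

End Orthogonality.

(** * Degree preservation *)

Section Triangularity.
Variables (R : realFieldType) (q : R).
Hypothesis q_gt0 : 0 < q.

Local Notation eta := (eta q).
Local Notation mean := (mean q).
Local Notation positive_parameters := (positive_parameters q).

(** * Functions of two variables with bounded total degree in eta *)

Section BivariatePolynomials.
Variable D : nat -> nat -> bool.

(** The outer variable of P stands for eta(t), the inner one for eta(z); the bound on the
    coefficients says that the total degree is at most n. The domain D serves to keep a truncated t
    - z honest. *)
Definition bipoly n (F : nat -> nat -> R) : Prop :=
  exists2 P : {poly {poly R}}, (forall m, (size (P`_m)%R <= n.+1 - m)%N) &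
    forall z t, D z t -> F z t = P.[(eta t)%:P].[eta z].

Lemma bipoly_eq n F G : (forall z t, D z t -> F z t = G z t) ->
  bipoly n G -> bipoly n F.
Proof. by move=> h [P szP hP]; exists P => // z t Dzt; rewrite h // hP. Qed.

Lemma bipoly_weaken m n F : (m <= n)%N -> bipoly m F -> bipoly n F.
Proof.
move=> le [P szP hP]; exists P => // i.
by rewrite (leq_trans (szP i)) // leq_sub2r.
Qed.

Lemma bipoly_const n c : bipoly n (fun _ _ => c).
Proof.
exists c%:P%:P => [m|z t _]; last by rewrite !hornerC.
by rewrite coefC; case: m => [|m] /=; rewrite ?size_poly0 // (leq_trans (size_polyC_leq1 _)).
Qed.

Lemma bipoly_fst : bipoly 1 (fun z _ => eta z).
Proof.
exists ('X)%:P => [m|z t _]; last by rewrite hornerC hornerX.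
by rewrite coefC; case: m => [|m] /=; rewrite ?size_poly0 // size_polyX.
Qed.

Lemma bipoly_snd : bipoly 1 (fun _ t => eta t).
Proof.
exists 'X => [m|z t _]; last by rewrite hornerX hornerC.
rewrite coefX; case: m => [|[|m]] /=; rewrite ?size_poly0 //.
by rewrite size_poly1.
Qed.

Lemma bipolyD n F G : bipoly n F -> bipoly n G ->
  bipoly n (fun z t => F z t + G z t).
Proof.
move=> [P szP hP] [Q szQ hQ]; exists (P + Q) => [m|z t Dzt].
  by rewrite coefD (leq_trans (size_polyD _ _)) // geq_max szP szQ.
by rewrite hP // hQ // !hornerD.
Qed.

Lemma bipoly_sum n m (F : nat -> nat -> nat -> R) :
  (forall k, (k < m)%N -> bipoly n (F k)) ->
  bipoly n (fun z t => \sum_(k < m) F k z t).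
Proof.
elim: m => [|m IH] h.
  by apply: bipoly_eq (bipoly_const n 0) => z t _; rewrite big_ord0.
apply: bipoly_eq (bipolyD (IH _) (h m _)) => //.
  by move=> z t _; rewrite big_ord_recr.
by move=> k lt; apply: h; rewrite ltnW.
Qed.

Lemma bipolyM m n F G : bipoly m F -> bipoly n G ->
  bipoly (m + n) (fun z t => F z t * G z t).
Proof.
move=> [P szP hP] [Q szQ hQ]; exists (P * Q) => [i|z t Dzt]; last first.
  by rewrite hP // hQ // !hornerM.
rewrite coefM; apply: leq_trans (size_sum _ _ _) _; apply/bigmax_leqP => -[j ltj] _ /=.
have [->|Pj0] := eqVneq P`_j 0; first by rewrite mul0r size_poly0.
have [->|Qj0] := eqVneq Q`_(i - j) 0; first by rewrite mulr0 size_poly0.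
apply: leq_trans (size_polyMleq _ _) _.
have := szP j; have := szQ (i - j)%N.
move: Pj0 Qj0; rewrite -!size_poly_gt0; move: (size _) (size _) => s1 s2; lia.
Qed.

Lemma bipolyX n F k : bipoly n F -> bipoly (n * k) (fun z t => F z t ^+ k).
Proof.
move=> hF; elim: k => [|k IH]; first exact: bipoly_const.
rewrite mulnS; apply: bipoly_eq (bipolyM hF IH) => z t _; exact: exprS.
Qed.

Lemma bipoly_snd_poly n (p : {poly R}) : (size p <= n.+1)%N ->
  bipoly n (fun _ t => p.[eta t]).
Proof.
move=> szp; apply: (@bipoly_eq _ _ (fun _ t => \sum_(k < n.+1) p`_k * eta t ^+ k)).
  by move=> _ t _; rewrite (horner_coef_wide _ szp).
apply: (@bipoly_sum n _ (fun k _ t => p`_k * eta t ^+ k)) => k lt.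
apply: (@bipoly_weaken (0 + 1 * k)); first by lia.
exact: bipolyM (bipoly_const _ _) (bipolyX _ bipoly_snd).
Qed.

(** The shape produced by expanding p(eta(z) + s) and averaging over s: [e k] is the k-th moment of
    s, and term i has total degree at most (i - k) + k. *)
Lemma bipoly_binomial n (c : nat -> R) (e : nat -> nat -> nat -> R) :
  (forall k, bipoly k (e k)) ->
  bipoly n (fun z t => \sum_(i < n.+1) c i *
    \sum_(k < i.+1) 'C(i, k)%:R * (eta z ^+ (i - k) * e k z t)).
Proof.
move=> he; apply: (@bipoly_sum n _ (fun i z t => c i *
    \sum_(k < i.+1) 'C(i, k)%:R * (eta z ^+ (i - k) * e k z t))) => i lti.
apply: (@bipoly_weaken (0 + i)); first by lia.
apply: bipolyM (bipoly_const _ _) _.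
apply: (@bipoly_sum i _ (fun k z t =>
    'C(i, k)%:R * (eta z ^+ (i - k) * e k z t))) => k ltk.
apply: (@bipoly_weaken (0 + (1 * (i - k) + k))); first by lia.
apply: bipolyM (bipoly_const _ _) _; apply: bipolyM (he k).
exact: bipolyX bipoly_fst.
Qed.

End BivariatePolynomials.

Lemma horner_binomial n (p : {poly R}) (s t : R) : (size p <= n.+1)%N ->
  p.[s + t] = \sum_(i < n.+1) p`_i *
    \sum_(k < i.+1) 'C(i, k)%:R * (s ^+ (i - k) * t ^+ k).
Proof.
move=> szp; rewrite (horner_coef_wide _ szp); apply: eq_bigr => i _.
by rewrite exprDn; congr (_ * _); apply: eq_bigr => k _; rewrite mulr_natl.
Qed.

Lemma mean_binomial a b d M n (p : {poly R}) (s : R) (g : nat -> R) :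
  (size p <= n.+1)%N ->
  mean a b d M (fun u => p.[s + g u]) = \sum_(i < n.+1) p`_i *
    \sum_(k < i.+1) 'C(i, k)%:R * (s ^+ (i - k) * mean a b d M (fun u => g u ^+ k)).
Proof.
move=> szp; rewrite (@eq_mean _ _ _ _ _ _ _ (fun u => \sum_(i < n.+1) p`_i *
    \sum_(k < i.+1) ('C(i, k)%:R * s ^+ (i - k)) * g u ^+ k)).
  rewrite mean_sum; apply: eq_bigr => i _; congr (_ * _).
  by rewrite mean_sum; apply: eq_bigr => k _; rewrite mulrA.
move=> u _; rewrite (horner_binomial _ _ szp); apply: eq_bigr => i _; congr (_ * _).
by apply: eq_bigr => k _; rewrite mulrA.
Qed.

(** As eta(z + u) = eta(z) + q^-z eta(u), it is enough to bound by k the total degree of the k-th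
    moment of q^-z eta(u). *)
Lemma bipoly_mean_add a b d n (p : {poly R}) :
  positive_parameters a b d -> (size p <= n.+1)%N ->
  bipoly leq n (fun z t => mean a b d (t - z) (fun u => p.[eta (z + u)])).
Proof.
move=> pos szp.
pose e k z t := mean a b d (t - z) (fun u => (q ^- z * eta u) ^+ k).
apply: bipoly_eq (@bipoly_binomial leq n (nth 0 p) e _).
  move=> z t _; rewrite -(mean_binomial _ _ _ _ _ _ szp); apply: eq_mean => u _.
  by rewrite etaD.
move=> k; have szX : (size ('X^k : {poly R}) <= k.+1)%N by rewrite size_polyXn.
have [r szr hr] := mean_poly q_gt0 pos szX.
apply: (@bipoly_eq _ _ _ (fun z t => \sum_(l < k.+1)
   r`_l * ((1 - (1 - q) * eta z) ^+ (k - l) * (eta t - eta z) ^+ l))).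
  move=> z t le; rewrite /e.
  rewrite (@eq_mean _ _ _ _ _ _ _ (fun u => q ^- z ^+ k * ('X^k).[eta u])); last first.
    by move=> u _; rewrite hornerXn exprMn.
  rewrite meanZ hr (horner_coef_wide _ szr) mulr_sumr; apply: eq_bigr => l _.
  (* Of the k factors q^-z, l are used to turn eta(t - z)^l into (eta(t) - eta(z))^l; the other k -
     l are affine in eta(z). *)
  rewrite -{2}(subnKC le) etaD // addrAC subrr add0r -expr_eta // exprMn.
  have lk : (l <= k)%N by rewrite -ltnS.
  by rewrite -{1}(subnK lk) exprD; ring.
apply: (@bipoly_sum leq k _ (fun l z t =>
   r`_l * ((1 - (1 - q) * eta z) ^+ (k - l) * (eta t - eta z) ^+ l))) => l ltl.
apply: (@bipoly_weaken _ (0 + (1 * (k - l) + 1 * l))); first by lia.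
have lin u v w : bipoly leq 1 (fun z t => u + v * eta z + w * eta t).
  apply: bipolyD.
    apply: bipolyD; first exact: bipoly_const.
    exact: (bipolyM (m := 0) (bipoly_const _ _ _) (bipoly_fst _)).
  exact: (bipolyM (m := 0) (bipoly_const _ _ _) (bipoly_snd _)).
apply: bipolyM (bipoly_const _ _ _) _; apply: bipolyM; apply: bipolyX.
  by apply: bipoly_eq (lin 1 (- (1 - q)) 0) => z t _; ring.
by apply: bipoly_eq (lin 0 (- 1) 1) => z t _; ring.
Qed.

(** * Functions on {0, ..., N} that are polynomial in eta *)

Variable N : nat.

Definition unipoly n (f : nat -> R) : Prop :=
  exists2 p : {poly R}, (size p <= n.+1)%N & forall x, (x <= N)%N -> f x = p.[eta x].

Lemma unipoly_eq n f g : (forall x, (x <= N)%N -> f x = g x) -> unipoly n g -> unipoly n f.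
Proof. by move=> h [p szp hp]; exists p => // x le; rewrite h // hp. Qed.

Lemma unipoly_mean a b d n f : positive_parameters a b d -> unipoly n f ->
  unipoly n (fun y => mean a b d y f).
Proof.
move=> pos [p szp hp]; have [r szr hr] := mean_poly q_gt0 pos szp.
exists r => // y le; rewrite -hr; apply: eq_mean => x lx.
by rewrite hp // (leq_trans lx).
Qed.

Lemma unipoly_sum n m (f : nat -> nat -> R) :
  (forall k, (k < m)%N -> unipoly n (f k)) ->
  unipoly n (fun x => \sum_(k < m) f k x).
Proof.
elim: m => [|m IH] h.
  by exists 0 => [|x _]; rewrite ?size_poly0 ?big_ord0 ?horner0.
have [p szp hp] := h m (leqnn _).
have [|r szr hr] := IH; first by move=> k lt; apply: h; rewrite ltnW.
exists (r + p) => [|x le]; last by rewrite big_ord_recr hornerD /= hp // hr.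
by rewrite (leq_trans (size_polyD _ _)) // geq_max szp szr.
Qed.

Lemma unipolyM m n f g : unipoly m f -> unipoly n g ->
  unipoly (m + n) (fun x => f x * g x).
Proof.
move=> [p szp hp] [r szr hr]; exists (p * r) => [|x le].
  by apply: leq_trans (size_polyMleq _ _) _; move: szp szr; move: (size _) (size _) => ? ?; lia.
by rewrite hornerM hp // hr.
Qed.

Lemma unipoly_bipoly D n F t : bipoly D n F -> (forall z, (z <= N)%N -> D z t) ->
  unipoly n (fun z => F z t).
Proof.
move=> [P szP hP] h; exists P.[(eta t)%:P] => [|z le]; last by rewrite hP // h.
rewrite horner_coef; apply: leq_trans (size_sum _ _ _) _; apply/bigmax_leqP => m _.
rewrite -polyC_exp mulrC mul_polyC (leq_trans (size_scale_leq _ _)) //.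
by rewrite (leq_trans (szP m)) // leq_subr.
Qed.

(** For fixed y the summations over z and v are independent, so each monomial of F averages to a
    product. The coefficient of the m-th power of eta(tau) gives degree n - m in eta(y), the power
    itself degree m. *)
Lemma unipoly_mean_mean a1 b1 d1 a2 b2 d2 D n F (tau : nat -> nat -> nat) :
  positive_parameters a1 b1 d1 -> bipoly D n F ->
  (forall y z v, (z <= y <= N)%N -> (v <= N - y)%N -> D z (tau y v)) ->
  (forall m, unipoly m (fun y => mean a2 b2 d2 (N - y) (fun v => eta (tau y v) ^+ m))) ->
  unipoly n (fun y => mean a1 b1 d1 y (fun z =>
                        mean a2 b2 d2 (N - y) (fun v => F z (tau y v)))).
Proof.
move=> pos [P szP hP] hD hL.
have szP' : (size P <= n.+1)%N.
  apply/leq_sizeP => j le; apply/eqP; rewrite -size_poly_leq0 (leq_trans (szP j)) //.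
  by rewrite leqn0 subn_eq0.
apply: (@unipoly_eq _ _ (fun y => \sum_(m < n.+1)
   mean a1 b1 d1 y (fun z => (P`_m).[eta z]) *
   mean a2 b2 d2 (N - y) (fun v => eta (tau y v) ^+ m))).
  move=> y ley; rewrite (@eq_mean _ _ _ _ _ _ _ (fun z => \sum_(m < n.+1)
     mean a2 b2 d2 (N - y) (fun v => eta (tau y v) ^+ m) * (P`_m).[eta z])).
    by rewrite mean_sum; apply: eq_bigr => m _; rewrite mulrC.
  move=> z lez; rewrite (@eq_mean _ _ _ _ _ _ _ (fun v => \sum_(m < n.+1)
      (P`_m).[eta z] * eta (tau y v) ^+ m)).
    by rewrite mean_sum; apply: eq_bigr => m _; rewrite mulrC.
  move=> v lev; rewrite hP; last by rewrite hD // lez.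
  rewrite (horner_coef_wide _ szP') horner_sum; apply: eq_bigr => m _.
  by rewrite hornerM -polyC_exp hornerC.
apply: (@unipoly_sum n _ (fun m y => mean a1 b1 d1 y (fun z => (P`_m).[eta z]) *
   mean a2 b2 d2 (N - y) (fun v => eta (tau y v) ^+ m))) => m ltm.
rewrite -[n](@subnK m) //; apply: unipolyM (hL m).
apply: unipoly_mean pos _; exists P`_m => //.
by rewrite (leq_trans (szP m)) // subSn.
Qed.

(** * Degree preservation for the five convolutions *)

Section Convolutions.
Variables a1 b1 d1 a2 b2 d2 a3 b3 d3 : R.
Hypothesis pos1 : positive_parameters a1 b1 d1.
Hypothesis pos2 : positive_parameters a2 b2 d2.
Hypothesis pos3 : positive_parameters a3 b3 d3.
Variables (n : nat) (f : nat -> R).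
Hypothesis hf : unipoly n f.

(** [bipoly_mean_add] with t frozen at N makes the inner mean a polynomial in eta(z); the outer mean
    keeps its degree. *)
Lemma unipoly_convI : unipoly n (fun y =>
  mean a1 b1 d1 y (fun z => mean a2 b2 d2 (N - z) (fun u => f (z + u)%N))).
Proof.
have [p szp hp] := hf; apply: unipoly_mean => //.
have h := @unipoly_bipoly _ _ _ N (bipoly_mean_add pos2 szp) (fun z => id).
apply: unipoly_eq h => z lez; apply: eq_mean => u leu; rewrite hp //; lia.
Qed.

Lemma unipoly_mean_add a b d m g : positive_parameters a b d -> unipoly m g ->
  unipoly m (fun y => mean a b d (N - y) (fun v => g (y + v)%N)).
Proof.
move=> pos [p szp hp].
have h := @unipoly_bipoly _ _ _ N (bipoly_mean_add pos szp) (fun z => id).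
apply: unipoly_eq h => z lez; apply: eq_mean => u leu; rewrite hp //; lia.
Qed.

Lemma unipoly_convIII : unipoly n (fun y =>
  mean a1 b1 d1 (N - y) (fun v => mean a2 b2 d2 (y + v) f)).
Proof. exact: (unipoly_mean_add pos1 (unipoly_mean pos2 hf)). Qed.

(** The innermost mean is [bipoly_mean_add] at t = y + v, where z <= y <= t. *)
Lemma unipoly_convIV : unipoly n (fun y =>
  mean a1 b1 d1 y (fun z => mean a2 b2 d2 (N - y) (fun v =>
    mean a3 b3 d3 (y + v - z) (fun u => f (z + u)%N)))).
Proof.
have [p szp hp] := hf.
have h := unipoly_mean_mean (tau := addn) pos1 (bipoly_mean_add pos3 szp).
apply: unipoly_eq (h a2 b2 d2 _ _).
- move=> y ley; apply: eq_mean => z lez; apply: eq_mean => v lev.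
  by apply: eq_mean => u leu; rewrite hp //; lia.
- by move=> y z v; lia.
move=> m; apply: (@unipoly_mean_add a2 b2 d2 m (fun y => eta y ^+ m)) => //.
by exists 'X^m => [|x _]; rewrite ?size_polyXn ?hornerXn.
Qed.

(** * Convolutions (ii) and (v), where q = 1 and eta is additive *)

Hypothesis q1 : q = 1.

Lemma etaD1 x y : eta (x + y) = eta x + eta y.
Proof. by rewrite etaD // q1 expr1n invr1 mul1r. Qed.

(** Additivity makes eta(N - y) = eta(N) - eta(y) affine in eta(y). *)
Lemma unipoly_mean_compl a b d m g : positive_parameters a b d -> unipoly m g ->
  unipoly m (fun y => mean a b d (N - y) g).
Proof.
move=> pos [p szp hp]; have [r szr hr] := mean_poly q_gt0 pos szp.
exists (r \Po ((eta N)%:P - 'X)) => [|y ley].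
  rewrite size_comp_poly2 // addrC size_polyDl size_polyN size_polyX // size_polyC.
  by case: (_ == _).
rewrite horner_comp !hornerE -{2}(subnK ley) etaD1 addrK -hr.
apply: eq_mean => x lex; apply: hp; lia.
Qed.

Lemma unipoly_exp m : unipoly m (fun y => eta y ^+ m).
Proof. by exists 'X^m => [|x _]; rewrite ?size_polyXn ?hornerXn. Qed.

Lemma unipoly_convII : unipoly n (fun y =>
  mean a1 b1 d1 y (fun z => mean a2 b2 d2 (N - y) (fun u => f (z + u)%N))).
Proof.
have [p szp hp] := hf; pose D (z t : nat) := true.
have h : bipoly D n (fun z t => p.[eta (z + t)]).
  apply: bipoly_eq (@bipoly_binomial D n (nth 0 p) (fun k _ t => eta t ^+ k) _).
    by move=> z t _; rewrite etaD1 (horner_binomial _ _ szp).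
  by move=> k; rewrite -{1}[k]mul1n; apply: bipolyX (bipoly_snd _).
apply: unipoly_eq (unipoly_mean_mean (tau := fun y v => v)
  (a2 := a2) (b2 := b2) (d2 := d2) pos1 h _ _) => //.
  move=> y ley; apply: eq_mean => z lez; apply: eq_mean => v lev.
  by rewrite hp //; lia.
by move=> m; apply: unipoly_mean_compl => //; apply: unipoly_exp.
Qed.

Lemma unipoly_convV : unipoly n (fun y =>
  mean a1 b1 d1 y (fun z => mean a2 b2 d2 (N - y) (fun v =>
    mean a3 b3 d3 v (fun u => f (z + u)%N)))).
Proof.
have [p szp hp] := hf; pose D (z t : nat) := true.
have h : bipoly D n (fun z t => mean a3 b3 d3 t (fun u => p.[eta (z + u)])).
  apply: bipoly_eq (@bipoly_binomial D n (nth 0 p)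
    (fun k _ t => mean a3 b3 d3 t (fun u => eta u ^+ k)) _).
    move=> z t _; rewrite -(mean_binomial _ _ _ _ _ _ szp).
    by apply: eq_mean => u _; rewrite etaD1.
  move=> k; have szX : (size ('X^k : {poly R}) <= k.+1)%N by rewrite size_polyXn.
  have [r szr hr] := mean_poly q_gt0 pos3 szX.
  apply: bipoly_eq (bipoly_snd_poly _ szr) => z t _; rewrite -hr.
  by apply: eq_mean => u _; rewrite hornerXn.
apply: unipoly_eq (unipoly_mean_mean (tau := fun y v => v)
  (a2 := a2) (b2 := b2) (d2 := d2) pos1 h _ _) => //.
  move=> y ley; apply: eq_mean => z lez; apply: eq_mean => v lev.
  by apply: eq_mean => u leu; rewrite hp //; lia.
by move=> m; apply: unipoly_mean_compl => //; apply: unipoly_exp.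
Qed.

End Convolutions.
End Triangularity.

(* A pi-symmetric matrix whose transpose preserves the degree filtration maps
   p_n to kappa p_n plus a term of lower degree, and that term is orthogonal to itself. *)
Lemma symmetric_triangular_eigen (R : realFieldType) (N : nat) (e w : nat -> R)
    (K : 'M[R]_N.+1) (P : nat -> {poly R}) :
  (forall x, (x <= N)%N -> 0 < w x) ->
  (forall x y : 'I_N.+1, K x y * w y = K y x * w x) ->
  (forall n, (n <= N)%N -> size (P n) = n.+1) ->
  (forall n (p : {poly R}), (n <= N)%N -> (size p <= n)%N ->
     \sum_(x < N.+1) w x * (p.[e x] * (P n).[e x]) = 0) ->
  (forall n (p : {poly R}), (size p <= n)%N ->
     exists2 p' : {poly R}, (size p' <= n)%N &
       forall y : 'I_N.+1, \sum_(x < N.+1) K x y * p.[e x] = p'.[e y]) ->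
  exists kappa : nat -> R, forall n x : 'I_N.+1,
    \sum_(y < N.+1) K x y * w y * (P n).[e y] = kappa n * w x * (P n).[e x].
Proof.
move=> w_gt0 Ksym szP orth Kpoly.
suff h n : (n <= N)%N -> exists k, forall x : 'I_N.+1,
    \sum_(y < N.+1) K x y * w y * (P n).[e y] = k * w x * (P n).[e x].
  have /fin_all_exists [k hk] : forall n : 'I_N.+1, exists k, forall x : 'I_N.+1,
      \sum_(y < N.+1) K x y * w y * (P n).[e y] = k * w x * (P n).[e x].
    by move=> n; apply: h; rewrite -ltnS.
  by exists (fun n => k (inord n)) => n x; rewrite inord_val.
move=> leN; have szPn : (size (P n) <= n.+1)%N by rewrite szP.
have [p' szp' hp'] := Kpoly n.+1 _ szPn.
(* Symmetry replaces K acting on w P_n by w times the transpose acting on P_n. *)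
have KP x : \sum_(y < N.+1) K x y * w y * (P n).[e y] = w x * p'.[e x].
  rewrite -hp' mulr_sumr; apply: eq_bigr => y _.
  by rewrite Ksym mulrCA mulrA.
(* The choice of k cancels the coefficient of degree n in r. *)
set k := p'`_n / lead_coef (P n); set r := p' - k *: P n.
have lc0 : lead_coef (P n) != 0 by rewrite lead_coef_eq0 -size_poly_gt0 szP.
have szr : (size r <= n)%N.
  apply/leq_sizeP => j; rewrite leq_eqVlt => /predU1P[<-|lt].
    have lcE : (P n)`_n = lead_coef (P n) by rewrite lead_coefE szP.
    by rewrite coefB coefZ lcE divfK ?subrr.
  by rewrite coefB coefZ !nth_default ?mulr0 ?subrr ?szP // (leq_trans szp').
(* One factor r may be replaced by p', since r is orthogonal to P_n. Writing w p' as K(w P_n) and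
   exchanging the sums moves the transpose of K onto r; the result r' again has lower degree and is
   orthogonal to P_n. *)
have rr : \sum_(x < N.+1) w x * (r.[e x] * r.[e x]) = 0.
  transitivity (\sum_(x < N.+1) w x * p'.[e x] * r.[e x]).
    have h0 : \sum_(x < N.+1) k * (w x * (r.[e x] * (P n).[e x])) = 0.
      by rewrite -mulr_sumr orth ?mulr0.
    rewrite -[LHS]addr0 -[X in _ + X = _]h0 -big_split.
    apply: eq_bigr => x _ /=.
    have -> : p'.[e x] = r.[e x] + k * (P n).[e x] by rewrite /r !hornerE subrK.
    by ring.
  have [r' szr' hr'] := Kpoly _ _ szr.
  under eq_bigr do rewrite -KP mulr_suml.
  rewrite exchange_big -[RHS](orth _ _ leN szr'); apply: eq_bigr => y _.
  by rewrite -hr' !mulr_suml mulr_sumr; apply: eq_bigr => x _ /=; ring.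
exists k => x; rewrite KP.
have wo (y : 'I_N.+1) : 0 < w y by apply: w_gt0; rewrite -ltnS.
have /psumr_eq0P : forall y : 'I_N.+1, true -> 0 <= w y * (r.[e y] * r.[e y]).
  by move=> y _; apply: mulr_ge0; [exact: ltW | rewrite -expr2 sqr_ge0].
move=> /(_ rr x isT)/eqP; rewrite mulf_eq0 gt_eqF //=.
by rewrite mulf_eq0 orbb /r !hornerE subr_eq0 => /eqP->; ring.
Qed.

(** * The three families *)

Section Families.
Variables (R : realType) (q : R).
Hypothesis hq : 0 < q < 1.

Definition base (F : measure_family) : R := if F is QHahn then q else 1.

(* For q-Hahn, (1 - c q^i) / (1 - q) = (1 - c) / (1 - q) + c [i], and the factor
   a^(M-x) of the weight is absorbed in par_b and par_d. *)
Definition par_a (F : measure_family) : param R F -> R :=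
  match F return param R F -> R with
  | Krawtchouk => fun p => p
  | Hahn => fun l => l.1
  | QHahn => fun l => (1 - l.1) / (1 - q)
  end.

Definition par_b (F : measure_family) : param R F -> R :=
  match F return param R F -> R with
  | Krawtchouk => fun p => 1 - p
  | Hahn => fun l => l.2
  | QHahn => fun l => l.1 * ((1 - l.2) / (1 - q))
  end.

Definition par_d (F : measure_family) : param R F -> R :=
  match F return param R F -> R with
  | Krawtchouk => fun=> 0
  | Hahn => fun=> 1
  | QHahn => fun l => l.1 * l.2
  end.

Lemma base_gt0 F : 0 < base F.
Proof. by case: F => /=; rewrite ?ltr01 //; case/andP: hq. Qed.

Lemma onem_q_neq0 : 1 - q != 0.
Proof. by case/andP: hq => _ h; rewrite subr_eq0 eq_sym lt_eqF. Qed.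

Lemma qint1 n : qint 1 n = n%:R :> R.
Proof.
rewrite /qint; under eq_bigr do rewrite expr1n.
by rewrite sumr_const card_ord.
Qed.

Lemma qfact1 n : qfact 1 n = n`!%:R :> R.
Proof.
elim: n => [|n IH]; first by rewrite /qfact big_ord0.
by rewrite qfactS IH qint1 factS natrM mulrC.
Qed.

Lemma eta1 n : eta 1 n = - n%:R :> R.
Proof. by rewrite /eta qint1 expr1n invr1 mul1r. Qed.

Lemma qprod1 c n : qprod 1 c 1 n = poch c n :> R.
Proof. by apply: eq_bigr => i _; rewrite qint1 mul1r. Qed.

Lemma qprod_const r c n : qprod r c 0 n = c ^+ n :> R.
Proof.
rewrite /qprod; under eq_bigr do rewrite mul0r addr0.
by rewrite prodr_const card_ord.
Qed.

Lemma newton1 k n : (newton 1 k).[eta 1 n] = poch (- n%:R) k :> R.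
Proof.
rewrite horner_newton; apply: eq_bigr => i _.
by rewrite qint1 eta1 expr1n mul1r addrC.
Qed.

Lemma prod_scale (c : R) n (F : 'I_n -> R) :
  \prod_(i < n) (c * F i) = c ^+ n * \prod_(i < n) F i.
Proof. by rewrite big_split prodr_const card_ord. Qed.

Lemma qpoch_qprod c n :
  qpoch q c n = (1 - q) ^+ n * qprod q ((1 - c) / (1 - q)) c n.
Proof.
rewrite -prod_scale; apply: eq_bigr => i _; rewrite expr_qint.
by have h := onem_q_neq0; field.
Qed.

Lemma qpoch_qfact n : qpoch q q n = (1 - q) ^+ n * qfact q n.
Proof.
rewrite qpoch_qprod divff ?onem_q_neq0 //; congr (_ * _).
by apply: eq_bigr => i _; rewrite qintS.
Qed.

Lemma qpoch_newton k n :
  qpoch q (q ^- n) k = (1 - q) ^+ k * (newton q k).[eta q n].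
Proof.
rewrite horner_newton -prod_scale; apply: eq_bigr => i _.
rewrite expr_eta ?(base_gt0 QHahn) // expr_qint.
by ring.
Qed.

Lemma slope_QHahn (l : param R QHahn) : slope q (par_b l) (par_d l) = l.1.
Proof. by rewrite /slope /=; have h := onem_q_neq0; field. Qed.

Lemma par_sum_QHahn (l : param R QHahn) :
  par_a l + par_b l = (1 - l.1 * l.2) / (1 - q).
Proof. by rewrite /=; have h := onem_q_neq0; field. Qed.

Lemma weight_wt F (l : param R F) x M : (x <= M)%N ->
  weight q x M l = wt (base F) (par_a l) (par_b l) (par_d l) x M.
Proof.
move=> le; have hC : 'C(M, x)%:R = M`!%:R / (x`!%:R * (M - x)`!%:R) :> R.
  rewrite -(bin_fact le) !natrM mulfK // -natrM pnatr_eq0 -lt0n.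
  by rewrite muln_gt0 !fact_gt0.
case: F l => [p|[a b]|[a b]] /=; rewrite le.
- rewrite /wt !qfact1 -hC /slope subrr mul0r !addr0 !qprod_const.
  by rewrite [p + _]addrC subrK expr1n divr1 mulrA.
- by rewrite /wt !qfact1 -hC /slope subrr mul0r addr0 !qprod1.
rewrite -[a]/(a, b).1; set l : param R QHahn := (a, b).
rewrite /wt (slope_QHahn l) (par_sum_QHahn l) /par_b /par_d qprodZ.
rewrite !qpoch_qfact !qpoch_qprod /=.
(* With the exponent M split as x + (M - x), all powers of 1 - q cancel. *)
have -> : (1 - q) ^+ M = (1 - q) ^+ x * (1 - q) ^+ (M - x) by rewrite -exprD subnKC.
have h1 := qfact_neq0 (base_gt0 QHahn) x.
have h2 := qfact_neq0 (base_gt0 QHahn) (M - x).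
have := expf_neq0 x onem_q_neq0; have := expf_neq0 (M - x) onem_q_neq0.
rewrite /par_a /= !invfM; move: h1 h2 => /=.
move: ((qprod _ ((1 - a * b) / _) _ _)^-1) (qprod _ ((1 - a) / _) _ _) (qprod _ ((1 - b) / _) _ _).
move: ((1 - q) ^+ x) ((1 - q) ^+ (M - x)) => u v y z w h1 h2 hv hu.
by field; rewrite h1 h2 hv hu.
Qed.

Lemma weight_mean F (l : param R F) M (f : nat -> R) :
  \sum_(x < M.+1) weight q x M l * f x =
  mean (base F) (par_a l) (par_b l) (par_d l) M f.
Proof. by apply: eq_bigr => x _; rewrite weight_wt // -ltnS. Qed.

Lemma par_positive F (l : param R F) : admissible l ->
  positive_parameters (base F) (par_a l) (par_b l) (par_d l).
Proof.
case: F l => [p /andP[p0 p1]|[a b] [a0 b0]|l [/andP[a0 a1] b1]] i.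
- by rewrite /slope /= subrr !mul0r !addr0 mul0r !addr0 subr_gt0.
- by rewrite /slope /= subrr mul0r addr0 !mul1r !qint1 !ltr_wpDr ?ler0n.
have q0 := base_gt0 QHahn; rewrite (slope_QHahn l) /base /par_a /par_b /par_d.
have e (c : R) : (1 - c) / (1 - q) + c * qint q i = (1 - c * q ^+ i) / (1 - q).
  by rewrite (expr_qint q i); have h := onem_q_neq0; field.
have qi : 0 < q ^+ i <= 1.
  by case/andP: hq => h1 h2; rewrite exprn_gt0 //= exprn_ile1 // ltW.
have pos (c : R) : c < 1 -> 0 < (1 - c * q ^+ i) / (1 - q).
  move=> c1; rewrite divr_gt0 //; last by case/andP: hq => _; rewrite subr_gt0.
  rewrite subr_gt0; case/andP: qi => h1 h2.
  (* The parameter b of the q-Hahn family may be negative. *)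
  have [c0|c0] := lerP c 0.
    by rewrite (le_lt_trans _ ltr01) // mulr_le0_ge0 // ltW.
  by rewrite (le_lt_trans _ c1) // ler_piMr // ltW.
split; first by rewrite e pos.
by rewrite -[l.1 * l.2 * _]mulrA -mulrDr e mulr_gt0 ?pos.
Qed.

Lemma checkP_orthopoly F (l : param R F) N n x :
  checkP q N n x l =
  (orthopoly (base F) (par_a l) (par_b l) (par_d l) N n).[eta (base F) x].
Proof.
rewrite horner_sum; case: F l => [p|[a b]|[a b]]; rewrite /checkP big_mkord;
  apply: eq_bigr => k _; rewrite hornerZ.
- rewrite /base /par_a /par_b /par_d /slope !newton1 qfact1 expr1n.
  rewrite subrr !mul0r !addr0 qprod_const.
  (* For Krawtchouk all these factors are p + (1 - p) = 1. *)
  rewrite big1 => [|i _]; last by rewrite mul0r addr0 subrKC.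
  by rewrite !invfM; ring.
- rewrite /base /par_a /par_b /par_d /slope !newton1 qfact1 expr1n /=.
  rewrite subrr !mul0r !addr0 qprod1.
  have -> : poch (n%:R + a + b - 1) k = \prod_(i < k) (a + b + 1 * qint 1 (n.-1 + i)).
    apply: eq_bigr => -[i lti] _ /=; rewrite qint1 natrD.
    have n0 : (0 < n)%N by have := ltn_ord k; lia.
    by rewrite -{1}(prednK n0) -addn1 natrD; ring.
  by rewrite !invfM; ring.
set l : param R QHahn := (a, b).
rewrite (slope_QHahn l) (par_sum_QHahn l) /base /par_a /par_b /par_d /=.
have -> : qpoch q (a * b * q ^ (n%:Z - 1)) k =
   (1 - q) ^+ k * \prod_(i < k) ((1 - a * b) / (1 - q) + a * b * qint q (n.-1 + i)).
  rewrite -prod_scale; apply: eq_bigr => -[i lti] _ /=.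
  have n0 : (0 < n)%N by have := ltn_ord k; lia.
  have -> : n%:Z - 1 = n.-1 by lia.
  rewrite -exprnP -mulrA -exprD expr_qint.
  by have h := onem_q_neq0; field.
rewrite !qpoch_newton qpoch_qfact !qpoch_qprod !invfM.
move: (expf_neq0 k onem_q_neq0).
move: ((1 - q) ^+ k) ((qprod _ _ _ _)^-1) (((newton q k).[eta q N])^-1) ((qfact q k)^-1).
by move=> u A B C hu; field.
Qed.

End Families.

(** * The convolutions as iterated means *)

Lemma sum_interval (V : nmodType) a b n (G : nat -> V) : (a <= b < n)%N ->
  \sum_(x < n | (a <= x <= b)%N) G x = \sum_(u < (b - a).+1) G (a + u)%N.
Proof.
case/andP=> ab bn; transitivity (\sum_(a <= x < b.+1) G x).
  by rewrite (big_nat_widen _ _ n) // big_geq_mkord; apply: eq_bigl => x; lia.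
rewrite -{1}[a]add0n big_addn subSn // big_mkord.
by apply: eq_bigr => u _; rewrite addnC.
Qed.

(** Exchanges the sums over a region sliced in either direction and shifts both variables to start
    at 0. With the intermediate state outside, each weight is then summed over its whole support. *)
Lemma sum_region (R : pzSemiRingType) n m a b (lo hi alpha beta : nat -> nat)
    (W : nat -> nat -> R) (f : nat -> R) :
  (a <= b)%N -> (b < m)%N ->
  (forall x, (x < n)%N -> (hi x <= m)%N) ->
  (forall z, (a <= z <= b)%N -> (alpha z <= beta z < n)%N) ->
  (forall x z, (x < n)%N -> (z < m)%N ->
    ((lo x <= z < hi x) = (a <= z <= b) && (alpha z <= x <= beta z))%N) ->
  \sum_(x < n) (\sum_(lo x <= z < hi x) W x z) * f x =
  \sum_(v < (b - a).+1) \sum_(u < (beta (a + v) - alpha (a + v)).+1)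
    W (alpha (a + v) + u)%N (a + v)%N * f (alpha (a + v) + u)%N.
Proof.
move=> ab bm him hab hregion.
rewrite -(sum_interval (n := m) (fun z => \sum_(u < (beta z - alpha z).+1)
    W (alpha z + u)%N z * f (alpha z + u)%N)); last by rewrite ab.
transitivity (\sum_(x < n) \sum_(z < m | (lo x <= z < hi x)%N) W x z * f x).
  apply: eq_bigr => x _; rewrite (big_nat_widen _ _ m) ?him // big_geq_mkord.
  by rewrite mulr_suml; apply: eq_bigl => z; rewrite andbC.
rewrite (exchange_big_dep (fun z : 'I_m => a <= z <= b)%N) /=; last first.
  by move=> x z _; rewrite hregion // => /andP[].
apply: eq_bigr => z hz; rewrite -(sum_interval (n := n) (fun x => W x z * f x)); last exact: hab.
by apply: eq_bigl => x; rewrite hregion // hz.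
Qed.

Section ConvolutionSums.
Variables (R : realType) (q : R) (F : measure_family) (N : nat).
Variables (l1 l2 l3 : param R F) (f : nat -> R) (y : 'I_N.+1).

Local Notation w x M l := (weight q x%N M%N l).

Lemma conv_sumI :
  \sum_(x < N.+1) conv q N ConvI l1 l2 l3 x y * f x =
  \sum_(z < y.+1) w z y l1 * \sum_(u < (N - z).+1) w u (N - z) l2 * f (z + u)%N.
Proof.
have := ltn_ord y; rewrite ltnS => ley.
under eq_bigr do rewrite mxE.
rewrite (@sum_region _ _ N.+1 0 y (fun=> 0%N) (fun x => (minn x y).+1) id (fun=> N)
  (fun x z => w (x - z) (N - z) l2 * w z y l1)) //; try lia.
rewrite subn0; apply: eq_bigr => z _; rewrite add0n mulr_sumr.
by apply: eq_bigr => u _; rewrite addKn mulrCA mulrA.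
Qed.

Lemma conv_sumII :
  \sum_(x < N.+1) conv q N ConvII l1 l2 l3 x y * f x =
  \sum_(z < y.+1) w z y l1 * \sum_(u < (N - y).+1) w u (N - y) l2 * f (z + u)%N.
Proof.
have := ltn_ord y; rewrite ltnS => ley.
under eq_bigr do rewrite mxE.
rewrite (@sum_region _ _ N.+1 0 y (fun x => x + y - N)%N (fun x => (minn x y).+1)
  id (fun z => z + (N - y))%N (fun x z => w (x - z) (N - y) l2 * w z y l1)) //; try lia.
rewrite subn0; apply: eq_bigr => z _; rewrite add0n mulr_sumr addKn.
by apply: eq_bigr => u _; rewrite addKn mulrCA mulrA.
Qed.

Lemma conv_sumIII :
  \sum_(x < N.+1) conv q N ConvIII l1 l2 l3 x y * f x =
  \sum_(v < (N - y).+1) w v (N - y) l1 * \sum_(x < (y + v).+1) w x (y + v) l2 * f x.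
Proof.
have := ltn_ord y; rewrite ltnS => ley.
under eq_bigr do rewrite mxE.
rewrite (@sum_region _ _ N.+1 y N (fun x => maxn x y) (fun=> N.+1) (fun=> 0%N) id
  (fun x z => w x z l2 * w (z - y) (N - y) l1)) //; try lia.
apply: eq_bigr => v _; rewrite subn0 mulr_sumr.
by apply: eq_bigr => u _; rewrite addKn add0n mulrCA mulrA.
Qed.

Lemma conv_sumIV :
  \sum_(x < N.+1) conv q N ConvIV l1 l2 l3 x y * f x =
  \sum_(z < y.+1) w z y l1 * \sum_(v < (N - y).+1) w v (N - y) l2 *
    \sum_(u < (y + v - z).+1) w u (y + v - z) l3 * f (z + u)%N.
Proof.
have := ltn_ord y; rewrite ltnS => ley.
under eq_bigr do rewrite mxE.
(* First x and z2 are exchanged, with the sum over z1 kept inside the summand. *)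
rewrite (@sum_region _ _ N.+1 0 y (fun=> 0%N) (fun x => (minn x y).+1) id (fun=> N)
  (fun x z => w z y l1 * \sum_(maxn x y <= z1 < N.+1)
     w (x - z) (z1 - z) l3 * w (z1 - y) (N - y) l2)) //; try lia.
rewrite subn0; apply: eq_bigr => -[z ltz] _; rewrite add0n /=.
under eq_bigr do rewrite -mulrA addKn.
rewrite -mulr_sumr; congr (_ * _).
(* Next u = x - z2 and z1 are exchanged, for fixed z2 <= y. *)
rewrite (@sum_region _ _ N.+1 y N (fun u => maxn (z + u) y) (fun=> N.+1) (fun=> 0%N)
  (fun t => t - z)%N (fun u t => w u (t - z) l3 * w (t - y) (N - y) l2)
  (fun u => f (z + u)%N)) //; try lia.
apply: eq_bigr => v _; rewrite subn0 mulr_sumr.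
by apply: eq_bigr => u _; rewrite addKn add0n mulrCA mulrA.
Qed.

Lemma conv_sumV :
  \sum_(x < N.+1) conv q N ConvV l1 l2 l3 x y * f x =
  \sum_(z < y.+1) w z y l1 * \sum_(v < (N - y).+1) w v (N - y) l2 *
    \sum_(u < v.+1) w u v l3 * f (z + u)%N.
Proof.
have := ltn_ord y; rewrite ltnS => ley.
under eq_bigr do rewrite mxE.
rewrite (@sum_region _ _ N.+1 0 y (fun=> 0%N) (fun x => (minn x y).+1) id (fun=> N)
  (fun x z => w z y l1 * \sum_(x + y - z <= z1 < N.+1)
     w (x - z) (z1 - y) l3 * w (z1 - y) (N - y) l2)) //; try lia.
rewrite subn0; apply: eq_bigr => -[z ltz] _; rewrite add0n /=.
under eq_bigr do rewrite -mulrA addKn.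
rewrite -mulr_sumr; congr (_ * _).
rewrite (@sum_region _ _ N.+1 y N (fun u => z + u + y - z)%N (fun=> N.+1) (fun=> 0%N)
  (fun t => t - y)%N (fun u t => w u (t - y) l3 * w (t - y) (N - y) l2)
  (fun u => f (z + u)%N)) //; try lia.
apply: eq_bigr => v _; rewrite subn0 mulr_sumr addKn.
by apply: eq_bigr => u _; rewrite add0n mulrCA mulrA.
Qed.

End ConvolutionSums.

(** * From degree preservation to the eigenvectors *)

Lemma conv_triangular (R : realType) (q : R) (hq : 0 < q < 1) (N : nat)
    (F : measure_family) (c : convolution) (l1 l2 l3 : param R F) n (p : {poly R}) :
  allowed F c -> admissible l1 -> admissible l2 -> admissible l3 ->
  (size p <= n)%N ->
  exists2 p' : {poly R}, (size p' <= n)%N &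
    forall y : 'I_N.+1,
      \sum_(x < N.+1) conv q N c l1 l2 l3 x y * p.[eta (base q F) x] =
      p'.[eta (base q F) y].
Proof.
move=> hc hl1 hl2 hl3; case: n => [|n] szp.
  exists 0 => [|y]; first by rewrite size_poly0.
  move: szp; rewrite size_poly_leq0 => /eqP->; rewrite horner0 big1 // => x _.
  by rewrite horner0 mulr0.
have q0 := base_gt0 hq F.
have pos1 := par_positive hq hl1; have pos2 := par_positive hq hl2.
have pos3 := par_positive hq hl3.
have hp : unipoly (base q F) N n (fun x => p.[eta (base q F) x]) by exists p.
(* [unipoly] concerns functions on [nat]; [inord] returns the index itself for y <= N. *)
suff [p' szp' hp'] : unipoly (base q F) N n (fun y =>
    \sum_(x < N.+1) conv q N c l1 l2 l3 x (inord y) * p.[eta (base q F) x]).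
  by exists p' => // y; rewrite -hp' ?inord_val // -ltnS.
(* (ii) and (v) are allowed for the same families, those with base 1. *)
have q1 : allowed F ConvII -> base q F = 1 by case: (F).
have wm := weight_mean hq.
case: c hc => hc.
- apply: unipoly_eq (unipoly_convI q0 pos1 pos2 hp) => y ley.
  rewrite (conv_sumI q l1 l2 l3 (fun x => p.[eta (base q F) x])) inordK // -wm.
  by apply: eq_bigr => z _; rewrite -wm.
- apply: unipoly_eq (unipoly_convII q0 pos1 pos2 hp (q1 hc)) => y ley.
  rewrite (conv_sumII q l1 l2 l3 (fun x => p.[eta (base q F) x])) inordK // -wm.
  by apply: eq_bigr => z _; rewrite -wm.
- apply: unipoly_eq (unipoly_convIII q0 pos1 pos2 hp) => y ley.
  rewrite (conv_sumIII q l1 l2 l3 (fun x => p.[eta (base q F) x])) inordK // -wm.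
  by apply: eq_bigr => z _; rewrite -wm.
- apply: unipoly_eq (unipoly_convIV q0 pos1 pos2 pos3 hp) => y ley.
  rewrite (conv_sumIV q l1 l2 l3 (fun x => p.[eta (base q F) x])) inordK // -wm.
  apply: eq_bigr => z _; rewrite -wm; congr (_ * _).
  by apply: eq_bigr => v _; rewrite -wm.
apply: unipoly_eq (unipoly_convV q0 pos1 pos2 pos3 hp (q1 _)) => [y ley|]; last by case: (F) hc.
rewrite (conv_sumV q l1 l2 l3 (fun x => p.[eta (base q F) x])) inordK // -wm.
apply: eq_bigr => z _; rewrite -wm; congr (_ * _).
by apply: eq_bigr => v _; rewrite -wm.
Qed.

(** [Phi] is invertible by positivity and maps the vector phi0 P to the vector of entries weight
    times P, as phi0 squared is the weight; conjugation carries the eigenvector of K back. *)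
Lemma calH_eigen (R : realType) (q : R) (F : measure_family) (N : nat)
    (l : param R F) (K : 'M[R]_N.+1) (P : nat -> R) (k : R) :
  (forall x : 'I_N.+1, 0 < weight q x N l) ->
  (forall x : 'I_N.+1,
     \sum_(y < N.+1) K x y * weight q y N l * P y = k * weight q x N l * P x) ->
  forall x : 'I_N.+1,
    \sum_(y < N.+1) calH q l K x y * phi0 q N l y * P y = k * phi0 q N l x * P x.
Proof.
move=> w_gt0 hK x; pose v : 'cV[R]_N.+1 := \col_y (phi0 q N l y * P y).
have Phi_unit : Phi q N l \in unitmx.
  rewrite unitmxE det_diag unitfE; apply/prodf_neq0 => y _.
  by rewrite mxE gt_eqF // sqrtr_gt0.
have PhiE y : (Phi q N l *m v) y 0 = weight q y N l * P y.
  by rewrite mul_diag_mx !mxE mulrA -expr2 sqr_sqrtr // ltW.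
have eig : calH q l K *m v = k *: v.
  rewrite /calH -!mulmxA; have -> : K *m (Phi q N l *m v) = k *: (Phi q N l *m v).
    apply/colP => y; rewrite [LHS]mxE [RHS]mxE PhiE mulrA -hK; apply: eq_bigr => z _.
    by rewrite PhiE mulrA.
  by rewrite -scalemxAr mulmxA mulVmx // mul1mx.
have := congr1 (fun A : 'cV_N.+1 => A x 0) eig; rewrite !mxE mulrA => <-.
by apply: eq_bigr => y _; rewrite !mxE mulrA.
Qed.

Theorem theorem2p1 (R : realType) (q : R) (hq : 0 < q < 1)
  (N : nat) (hN : (1 <= N)%N)
  (F : measure_family) (c : convolution) (hc : allowed F c)
  (l1 l2 l3 : param R F)
  (hl1 : admissible l1) (hl2 : admissible l2) (hl3 : admissible l3)
  (K : 'M[R]_N.+1) (hK : K = conv q N c l1 l2 l3)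
  (l : param R F) (hl : admissible l)
  (hsym : forall x y : 'I_N.+1,
      K x y * weight q y N l = K y x * weight q x N l) :
  exists kappa : 'I_N.+1 -> R,
    forall n x : 'I_N.+1,
      \sum_(y < N.+1) calH q l K x y * phi0 q N l y * checkP q N n y l
        = kappa n * phi0 q N l x * checkP q N n x l
      /\
      \sum_(y < N.+1) K x y * weight q y N l * checkP q N n y l
        = kappa n * weight q x N l * checkP q N n x l.
Proof.
have q0 := base_gt0 hq F; have pos := par_positive hq hl.
have w_gt0 x : (x <= N)%N -> 0 < weight q x N l.
  by move=> le; rewrite weight_wt // wt_gt0.
have [n le|n p le szp|n p szp|kappa hkappa] := symmetric_triangular_eigen
    (e := eta (base q F)) (w := fun x => weight q x N l)
    (P := orthopoly (base q F) (par_a q l) (par_b q l) (par_d l) N) w_gt0 hsym.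
- exact: size_orthopoly.
- rewrite (weight_mean hq l N (fun x => p.[eta (base q F) x] *
    (orthopoly (base q F) (par_a q l) (par_b q l) (par_d l) N n).[eta (base q F) x])).
  exact: orthopoly_orthogonal.
- by rewrite hK; apply: conv_triangular.
exists (fun n => kappa n) => n.
have hKP (x : 'I_N.+1) : \sum_(y < N.+1) K x y * weight q y N l * checkP q N n y l
    = kappa n * weight q x N l * checkP q N n x l.
  rewrite checkP_orthopoly // -hkappa; apply: eq_bigr => y _.
  by rewrite checkP_orthopoly.
move=> x; split=> //.
apply: (calH_eigen (P := fun y => checkP q N n y l)) hKP x => x.
by apply: w_gt0; rewrite -ltnS.
Qed.
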